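(* Let $p$ be a prime and $G\cong \mathbb{Z}_p^n$. Let $\sigma$ be a skew-morphism of $G$ and let $X=G\langle \sigma\rangle$ be the skew-product group of $G$ by $\sigma$. Suppose $|\sigma|=k\cdot p^m\ge 2$, where $m\ge 0$ and $p\nmid k$, and put $P=G\langle \sigma^k\rangle$. Then $P\trianglelefteq X$, and either $G\trianglelefteq X$ or $G=G_X\times B$ for some subgroup $B\cong \mathbb{Z}_p$. More precisely, one of the following holds: (1) $m=0$ or $p=2$, and $X=G\rtimes \langle\sigma\rangle$; (2) $p\neq 2$, $m\ge 1$, $k=1$, and either $X=G\rtimes\langle\sigma\rangle$ or $X=(G_X\rtimes\langle\sigma\rangle)\rtimes B$; (3) $p\ne 2$, $m\ge 1$, $k\ge 2$, and either $X=G\rtimes\langle\sigma\rangle$; or $G\trianglelefteq P$ and $X=((G_X\times B)\rtimes\langle\sigma^k\rangle)\rtimes\langle \sigma^{p^m}\rangle$; or $G\ntrianglelefteq P$ and $X=((G_X\rtimes\langle\sigma^k\rangle)\rtimes B)\rtimes\langle\sigma^{p^m}\rangle$.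
   Context: A skew-morphism of a finite group $G$ is a permutation $\sigma$ of $G$ fixing the identity such that there is an integer-valued function $\pi$ on $G$ with $\sigma(gh)=\sigma(g)\sigma^{\pi(g)}(h)$ for all $g,h\in G$. For $g\in G$ let $L_g:h\mapsto gh$ be left multiplication. The skew-product group of $G$ by $\sigma$ is the permutation group $X=L_G\langle\sigma\rangle$ on $G$ (it is a group, $L_G\cap\langle\sigma\rangle=1$, and $\langle\sigma\rangle$ contains no nontrivial normal subgroup of $X$); $G$ is identified with $L_G$, so $X=G\langle\sigma\rangle$. $G_X$ denotes the core of $G$ in $X$, i.e. the largest normal subgroup of $X$ contained in $G$. $M\rtimes N$ denotes a (internal) semidirect product with $M$ normal. *)

(* Defs.v *)
From HB Require Import structures.
From mathcomp Require Import all_boot all_order all_algebra all_fingroup.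
From mathcomp Require Import all_solvable.

Set Implicit Arguments.
Unset Strict Implicit.
Unset Printing Implicit Defensive.

Local Open Scope group_scope.

(* Permutations compose left to right in MathComp: (s * t) x = t (s x).  So   *)
(* {perm gT} is the opposite of the symmetric group of the usual function     *)
(* composition.  Subgroups, products AB of subgroups with AB = BA, cores,     *)
(* normality and internal (semi)direct products are the same in both groups.  *)

Definition expgz (gT : finGroupType) (x : gT) (z : int) : gT :=
  match z with Posz n => x ^+ n | Negz n => x ^- n.+1 end.

Definition skew_morphism (gT : finGroupType) (sigma : {perm gT}) : Prop :=
  sigma 1 = 1 /\
  exists pi : gT -> int,
    forall g h : gT, sigma (g * h) = sigma g * expgz sigma (pi g) h.

Definition lmulp (gT : finGroupType) (g : gT) : {perm gT} := perm (@mulgI gT g).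

Definition lreg (gT : finGroupType) : {set {perm gT}} :=
  [set lmulp g | g in [set: gT]].

Lemma lmulpE (gT : finGroupType) (g h : gT) : lmulp g h = g * h.
Proof. by rewrite permE. Qed.

Lemma lreg_group_set (gT : finGroupType) : group_set (lreg gT).
Proof.
apply/group_setP; split.
  by apply/imsetP; exists 1 => //; apply/permP=> h; rewrite lmulpE mul1g perm1.
move=> _ _ /imsetP[g _ ->] /imsetP[h _ ->]; apply/imsetP; exists (h * g) => //.
by apply/permP=> x; rewrite permM !lmulpE mulgA.
Qed.

Canonical lreg_group (gT : finGroupType) : {group {perm gT}} :=
  Group (lreg_group_set gT).

Lemma expgz_cycle (gT : finGroupType) (x : gT) (z : int) : expgz x z \in <[x]>.
Proof. by case: z => n; rewrite ?groupV mem_cycle. Qed.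

Lemma skew_product_group_set (gT : finGroupType) (sigma : {perm gT}) :
  skew_morphism sigma -> group_set (lreg gT * <[sigma]>).
Proof.
case=> _ [pi sigmaM].
have sub : lreg gT * <[sigma]> \subset <[sigma]> * lreg gT.
  apply/subsetP=> _ /mulsgP[l _ lL /cycleP[i ->] ->].
  elim: i l lL => [|i IHi] l lL.
    by rewrite mulg1 -[l]mul1g mem_mulg.
  rewrite expgSr mulgA.
  have /mulsgP[s l1 sS /imsetP[g _ ->] ->] := IHi l lL.
  have -> : s * lmulp g * sigma = (s * expgz sigma (pi g)) * lmulp (sigma g).
    rewrite -!mulgA; congr (_ * _).
    by apply/permP=> h; rewrite !permM !lmulpE sigmaM.
  by rewrite mem_mulg ?groupM ?expgz_cycle //; apply/imsetP; exists (sigma g).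
apply/comm_group_setP; apply/eqP.
by rewrite eqEcard sub -[X in (X <= _)%N]card_invg invMg !invGid leqnn.
Qed.

Definition skew_product (gT : finGroupType) (sigma : {perm gT})
    (skew_sigma : skew_morphism sigma) : {group {perm gT}} :=
  Group (skew_product_group_set skew_sigma).

(* Main.v *)
(* Write X = GC with C = <sigma> and N the core of G in X.  By Ito's theorem  *)
(* X' is abelian, and it is a p-group because C is core-free.  Hence a Sylow  *)
(* p-subgroup of X containing G also contains X', so it is normal; it is P.   *)
(* Moreover X' :&: G = 'C_X'(G X') is normal, so it lies in N and G / N meets *)
(* the derived subgroup R of X / N trivially.                                 *)
(*   In X / N, let F be the cyclic group with (G / N) R = (G / N) F and       *)
(* F \subset C / N; then |F| = |R|.  For p odd, comparing p-th powers in F    *)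
(* and R shows that R is cyclic, so every commutator [g, c] of g in G / N     *)
(* with a generator c of C / N lies in 'Ohm_1(R); since g |-> [g, c] is       *)
(* injective, |G / N| <= p.  For p = 2, if R is not trivial, the involution   *)
(* of C is shown to centralise G, contradicting that C is core-free.          *)

Require Import Defs.
From HB Require Import structures.
From mathcomp Require Import all_boot all_order all_algebra all_fingroup.
From mathcomp Require Import all_solvable.
From mathcomp Require Import zify.

Set Implicit Arguments.
Unset Strict Implicit.
Unset Printing Implicit Defensive.

Local Open Scope group_scope.

(** The skew product enters only through [X = G C] with [C = <[sigma]>], [G :&: C = 1]
    ([lreg_cap_skew]) and [C] core-free ([gcore_skew]). The heart is that a non-normal [G] has a
    core [N] of index exactly [p] ([gcore_index_odd]), and that this never happens for [p = 2]
    ([elementary2_normal]). In [X / N] the factors exchange roles: [G / N] is core-free, so [C / N]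
    is self-centralising and meets the derived subgroup [R] in a normal subgroup of index dividing
    [p] in [R]. For [p] odd this makes [R] cyclic ([der1_cyclic]), and commutation with a generator
    of [C / N] embeds the set [G / N] into the subgroup of order [p] of [R] ([card_elementary_le]).
    The decompositions are then formal. [G] splits over [N], which gives [B]; [N <[sigma ^+ k]>] has
    index [p] in the [p]-group [P], so it is normal there with complement [B] ([sdprod_index_p]);
    and [P], normal by [normal_p_part], is complemented in [X] by the [p']-part of [C]. *)

(** * Products of two abelian groups and Ito's theorem *)

Lemma der1_mul_abelian (gT : finGroupType) (A B X : {group gT}) :
  A * B = X -> abelian A -> abelian B -> X^`(1) = [~: A, B].
Proof.
move=> defX cAA cBB.
have [sAX sBX] : A \subset X /\ B \subset X by rewrite -defX mulG_subl mulG_subr.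
have nXM: X \subset 'N([~: A, B]) by rewrite -defX mul_subG ?commg_norml
  ?commg_normr.
apply/eqP; rewrite eqEsubset [X in _ && X]commgSS // andbT der1_min //.
rewrite -defX quotientMl ?commg_norml // abelianM !quotient_abelian //=.
by rewrite quotient_cents2 ?commg_norml ?commg_normr // commGC.
Qed.

Lemma Ito_der1_abelian (gT : finGroupType) (A B X : {group gT}) :
  A * B = X -> abelian A -> abelian B -> abelian X^`(1).
Proof.
move=> defX cAA cBB; rewrite (der1_mul_abelian defX) // abelian_gen.
have defX' : B * A = X by rewrite -defX; apply/esym/comm_group_setP;
  rewrite defX groupP.
have [sAX sBX] : A \subset X /\ B \subset X by rewrite -defX mulG_subl mulG_subr.
have cA x y : x \in A -> y \in A -> x ^ y = x.
  by move=> Ax Ay; apply/conjg_fixP/commgP/(centsP cAA).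
have cB x y : x \in B -> y \in B -> x ^ y = x.
  by move=> Ax Ay; apply/conjg_fixP/commgP/(centsP cBB).
have RA x y z : x \in A -> y \in A -> [~ x, y * z] = [~ x, z].
  by move=> Ax Ay; rewrite commgMJ (_ : [~ x, y] = 1) ?conj1g ?mulg1 //;
    apply/eqP/commgP/(centsP cAA).
have RB x y z : x \in B -> z \in B -> [~ x * y, z] = [~ y, z].
  by move=> Ax Ay; rewrite commMgJ (_ : [~ x, z] = 1) ?conj1g ?mul1g //;
    apply/eqP/commgP/(centsP cBB).
have E a b a1 b1 : a \in A -> b \in B -> a1 \in A -> b1 \in B ->
    [~ a, b] ^ (a1 * b1) = [~ a, b] ^ (b1 * a1).
  move=> Aa Bb Aa1 Bb1.
  have /mulsgP[b2 a2 Bb2 Aa2 Eb1] : a ^ b1 \in B * A.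
    by rewrite defX' groupJ ?(subsetP sAX a) ?(subsetP sBX b1).
  have /mulsgP[a3 b3 Aa3 Bb3 Ea1] : b ^ a1 \in A * B.
    by rewrite defX groupJ ?(subsetP sAX a1) ?(subsetP sBX b).
  rewrite !conjgM !(conjRg a b) (cA a) // Ea1 RA // conjRg (cB b3) // Eb1 RB //.
  by rewrite (cB b) // RB // conjRg (cA a2) // Ea1 RA.
apply/centsP=> _ /imset2P[a b Aa Bb ->] _ /imset2P[a1 b1 Aa1 Bb1 ->].
apply/commgP/conjg_fixP.
have -> : [~ a1, b1] = (a1^-1 * b1^-1) * (b1^-1 * a1^-1)^-1.
  by rewrite commgEl /conjg invMg !invgK !mulgA.
by rewrite conjgM E ?groupV // -conjgM mulgV conjg1.
Qed.

(** If [a * b] centralises [A], so does [b]; as [B] is abelian, [b] is then central in [X], and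
    [<[b]>] lies in the trivial core of [B]. *)
Lemma cent_abelian_factor (gT : finGroupType) (A B X : {group gT}) :
  A * B = X -> abelian A -> abelian B -> gcore B X = 1 -> 'C_X(A) = A.
Proof.
move=> defX cAA cBB core1.
have [sAX sBX] : A \subset X /\ B \subset X by rewrite -defX mulG_subl mulG_subr.
apply/eqP; rewrite eqEsubset subsetI sAX [A \subset _]cAA !andbT.
apply/subsetP=> x /setIP[]; rewrite -{1}defX => /mulsgP[a b Aa Bb ->] cab.
have cAb : b \in 'C(A) by rewrite -(groupMl b (subsetP cAA a Aa)).
suff: <[b]> \subset gcore B X.
  by rewrite core1 cycle_subG => /set1gP->; rewrite mulg1.
apply: gcore_max; rewrite ?cycle_subG //.
apply: subset_trans (cent_sub _);
  rewrite centsC cycle_subG /= -defX centM inE cAb.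
exact: subsetP cBB b Bb.
Qed.

(** Since [X^](1)[is abelian and]A[self-centralising, the intersection is the centraliser in]X^[(1)]
    of [A <*> X^](1)[, which is normal because it contains]X^[(1)]. *)
Lemma der1_cap_factor_normal (gT : finGroupType) (A B X : {group gT}) :
  A * B = X -> abelian A -> abelian B -> gcore B X = 1 ->
  X^`(1) :&: A <| X.
Proof.
move=> defX cAA cBB core1.
have [sAX sBX] : A \subset X /\ B \subset X by rewrite -defX mulG_subl mulG_subr.
have sX'X := der_sub 1 X; have nX'X := der_norm 1 X.
have -> : X^`(1) :&: A = 'C_(X^`(1))(A <*> X^`(1)).
  rewrite centY setICA (setIidPl (Ito_der1_abelian defX cAA cBB)).
  by rewrite -{1}(cent_abelian_factor defX cAA cBB core1) setIA (setIidPl sX'X)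
    setIC.
have nAX' : A <*> X^`(1) <| X.
  by rewrite sub_der1_normal ?joing_subr // join_subG sAX.
rewrite /normal subIset ?sX'X //= normsI ?norms_cent //.
exact: normal_norm nAX'.
Qed.

(** * Normal subgroups of order prime to [p], and the derived subgroup *)

Section CoreFreeCyclic.

Variables (gT : finGroupType) (p : nat) (G C X : {group gT}).
Hypotheses (p_pr : prime p) (abelG : p.-abelem G) (cycC : cyclic C).
Hypotheses (defX : G * C = X) (tiGC : G :&: C = 1) (coreC : gcore C X = 1).

Let pG : p.-group G. Proof. exact: abelem_pgroup abelG. Qed.
Let cGG : abelian G. Proof. exact: abelem_abelian abelG. Qed.
Let cCC : abelian C. Proof. exact: cyclic_abelian cycC. Qed.
Let sGX : G \subset X. Proof. by rewrite -defX mulG_subl. Qed.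
Let sCX : C \subset X. Proof. by rewrite -defX mulG_subr. Qed.

(** The index of [C] in [C M] divides both [#|X : C|], a power of [p], and [#|M|], so it is 1 and
    [M] lies in the core of [C]. *)
Lemma normal_p'group_trivial (M : {group gT}) : M <| X -> p^'.-group M -> M :=: 1.
Proof.
case/andP=> sMX nMX p'M; apply/trivgP; rewrite -coreC gcore_max //.
have nMC : C \subset 'N(M) := subset_trans sCX nMX.
have defX' : C * G = X by rewrite -defX; apply/esym/comm_group_setP;
  rewrite defX groupP.
have p_ind : p.-nat #|X : C| by rewrite -defX' indexMg -indexgI (pnat_dvd
  (dvdn_indexg _ _)).
have defMC : C <*> M = C * M by rewrite norm_joinEl.
rewrite -indexg_eq1 -indexMg -defMC.
rewrite -(@pnat_1 p #|C <*> M : C|) //.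
  by rewrite (pnat_dvd _ p_ind) // indexSg ?joing_subl // join_subG sCX.
by rewrite defMC indexMg (pnat_dvd (dvdn_indexg _ _)).
Qed.

Lemma der1_pgroup : p.-group X^`(1).
Proof.
have abX' := Ito_der1_abelian defX cGG cCC.
have /trivgP : 'O_p^'(X^`(1)) = 1.
  apply: normal_p'group_trivial; last exact: pcore_pgroup.
  exact: char_normal_trans (pcore_char _ _) (der_normal 1 X).
move=> tO; have := nilpotent_pcoreC p (abelian_nil abX').
by rewrite (trivgP tO) dprodg1 => <-; apply: pcore_pgroup.
Qed.
End CoreFreeCyclic.

(** * Commutators and [p]-th powers in [p]-groups *)

(** A normal subgroup of order [p] in the [p]-group [Q / H] meets the centre, hence is central. *)
Lemma comm_sub_prime_index (gT : finGroupType) (p : nat) (H K Q : {group gT}) :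
    prime p -> p.-group Q -> H <| Q -> K <| Q -> H \subset K -> #|K : H| %| p ->
  [~: K, Q] \subset H.
Proof.
move=> p_pr pQ /andP[sHQ nHQ] nsKQ sHK dvd_ind.
rewrite -quotient_cents2 //; last exact: subset_trans (normal_sub nsKQ) nHQ.
have nHK : K \subset 'N(H) := subset_trans (normal_sub nsKQ) nHQ.
have [->|ntK] := eqVneq (K / H) 1; first exact: sub1G.
have prK : prime #|K / H|.
  rewrite card_quotient //; have [_ /(_ _ dvd_ind)/orP[]/eqP E1] := primeP p_pr;
    rewrite ?E1 //.
  by case/eqP: ntK; apply: quotientS1; rewrite -indexg_eq1 E1.
have := meet_center_nil (pgroup_nil (quotient_pgroup H pQ)) (quotient_normal H
  nsKQ) ntK.
by move/(prime_meetG prK); rewrite subsetI => /andP[].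
Qed.

Lemma expMg_conj_cycle (gT : finGroupType) (g y : gT) (a n : nat) :
  y ^ g = y ^+ a -> (g * y) ^+ n = g ^+ n * y ^+ (\sum_(i < n) a ^ i).
Proof.
move=> yg; elim: n => [|n IHn]; first by rewrite big_ord0 mulg1.
rewrite big_ord_recl.
under eq_bigr do rewrite lift0 expnS.
rewrite expgSr IHn -big_distrr /= expn0 addnC expgD expg1 expgM -yg -conjXg.
by rewrite expgSr conjgE !mulgA mulgK.
Qed.

Lemma prime_dvd_bin2 (p : nat) : prime p -> p != 2 -> p %| 'C(p, 2).
Proof.
by move=> p_pr p2; rewrite prime_dvd_bin //= ltn_neqAle eq_sym p2 prime_gt1.
Qed.

(** Modulo [p ^ 2] the [i]-th term is [1 + i * p * j], so the sum is [p + p * j * 'C(p, 2)], and [p]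
    divides ['C(p, 2)] for odd [p]. *)
Lemma sum_exp_prime (p j : nat) : prime p -> p != 2 ->
  exists w, \sum_(i < p) (p * j).+1 ^ i = (p * (p * w).+1)%N.
Proof.
move=> p_pr p2.
have S n : exists q, \sum_(i < n) (p * j).+1 ^ i = (n + p * j * 'C(n, 2) + p * p
  * q)%N.
  elim: n => [|n [q IHn]]; first by exists 0; rewrite big_ord0 bin0n !muln0.
  rewrite big_ord_recl.
  under eq_bigr do rewrite lift0 expnS.
  rewrite -big_distrr /= IHn expn0 binS bin1.
  exists (j * j * 'C(n, 2) + q + p * j * q)%N.
  nia.
have [q ->] := S p.
have /dvdnP[r ->] := prime_dvd_bin2 p_pr p2.
by exists (j * r + q)%N; nia.
Qed.

(** Let [y ^ g = y ^+ a]. From [g ^+ p = 1] follows [a ^ p = 1] modulo [p], so [a = 1] modulo [p] by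
    Fermat. Then [(g * y) ^+ p] is a power of [y] whose exponent is [p] times a number prime to
    [p]. *)
Lemma exp_eq1_of_conj (gT : finGroupType) (p : nat) (g y : gT) :
    prime p -> p != 2 -> p.-elt y -> g \in 'N(<[y]>) ->
    g ^+ p = 1 -> (g * y) ^+ p = 1 -> y ^+ p = 1.
Proof.
move=> p_pr p2 py nyg gp gyp.
have [->|nty] := eqVneq y 1; first exact: expg1n.
have /cycleP[a yg] : y ^ g \in <[y]> by rewrite memJ_norm ?cycle_id.
have ygn n : y ^ (g ^+ n) = y ^+ (a ^ n).
  elim: n => [|n IHn]; first by rewrite conjg1.
  by rewrite expgSr conjgM IHn conjXg yg -expgM expnS.
have p_dvd : p %| #[y].
  by have [|_ ? _] := pgroup_pdiv py; rewrite ?cycle_eq1.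
have ap : a ^ p = 1 %[mod #[y]].
  by apply/eqP; rewrite -eq_expg_mod_order expg1 -ygn gp conjg1.
have {}ap : a ^ p = 1 %[mod p].
  by rewrite -(modn_dvdm (a ^ p) p_dvd) ap modn_dvdm.
have co_ap : coprime a p.
  rewrite coprime_sym prime_coprime //; apply/negP => p_a.
  have : p %| a ^ p by rewrite (dvdn_trans p_a) // dvdn_exp // prime_gt0.
  by rewrite /dvdn ap modn_small ?prime_gt1.
have a1 : a = 1 %[mod p].
  have := Euler_exp_totient co_ap; rewrite totient_prime // => aE.
  by rewrite -ap -(prednK (prime_gt0 p_pr)) expnS -[in RHS]modnMmr prednK
    ?prime_gt0 // aE modnMmr muln1.
have Ea : a = (p * (a %/ p)).+1.
  by rewrite {1}(divn_eq a p) a1 modn_small ?prime_gt1 // addn1 mulnC.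
have [w Ew] := sum_exp_prime (a %/ p) p_pr p2.
move: gyp; rewrite (expMg_conj_cycle _ yg) gp mul1g Ea Ew => /eqP.
rewrite -order_dvdn Gauss_dvdl; first by rewrite order_dvdn => /eqP.
have [k ->] := p_natP py.
by apply: coprimeXl;
  rewrite prime_coprime // -addn1 dvdn_addr ?dvdn_mulr // dvdn1;
    case: (p) p_pr => [|[|]].
Qed.

Lemma order_eq_of_expp (gT : finGroupType) (p : nat) (x y : gT) :
  prime p -> p.-elt x -> p.-elt y -> x ^+ p = y ^+ p -> x ^+ p != 1 -> #[x] =
    #[y].
Proof.
move=> p_pr px py Exy ntx.
have E (z : gT) : p.-elt z -> z ^+ p != 1 -> #[z] = (p * #[z ^+ p])%N.
  move=> pz ntz; have [k Ek] := p_natP pz.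
  have k_gt0 : 0 < k.
    by case: k Ek => // /eqP; rewrite order_eq1 => /eqP z1;
      rewrite z1 expg1n eqxx in ntz.
  have p_dvd : p %| #[z] by rewrite Ek dvdn_exp.
  by rewrite orderXdiv // mulnC divnK.
by rewrite (E x) // (E y) -?Exy.
Qed.

Lemma norm_card2_cent (gT : finGroupType) (A : {set gT}) (H : {group gT}) :
  #|H| = 2 -> A \subset 'N(H) -> A \subset 'C(H).
Proof.
move=> H2 /subsetP nHA;
  have /cyclicP[t defH] : cyclic H by rewrite prime_cyclic ?H2.
have Dt : H = [set 1; t] :> {set gT} by rewrite defH cycle2g // -H2 defH.
have ntt : t != 1 by rewrite -order_gt1 /order -defH H2.
apply/subsetP=> x /nHA nHx; rewrite defH cent_cycle;
  apply/cent1P/commute_sym/commgP/conjg_fixP.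
have : t ^ x \in H by rewrite memJ_norm // Dt !inE eqxx orbT.
by rewrite Dt !inE conjg_eq1 (negPf ntt) => /eqP.
Qed.

(** * The case of a core-free [G] meeting the derived subgroup trivially, to be applied to
    [X / N] *)

Section CoreFreeElementary.

Variables (gT : finGroupType) (p : nat) (G C X : {group gT}).
Hypotheses (p_pr : prime p) (abelG : p.-abelem G) (cycC : cyclic C).
Hypotheses (defX : G * C = X) (tiGC : G :&: C = 1) (coreG : gcore G X = 1).
Hypotheses (pR : p.-group X^`(1)) (tiGR : G :&: X^`(1) = 1).

Let pG : p.-group G. Proof. exact: abelem_pgroup abelG. Qed.
Let cGG : abelian G. Proof. exact: abelem_abelian abelG. Qed.
Let cCC : abelian C. Proof. exact: cyclic_abelian cycC. Qed.
Let sGX : G \subset X. Proof. by rewrite -defX mulG_subl. Qed.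
Let sCX : C \subset X. Proof. by rewrite -defX mulG_subr. Qed.
Let defX' : C * G = X.
Proof. by rewrite -defX; apply/esym/comm_group_setP; rewrite defX groupP. Qed.

Local Notation R := (X^`(1))%G.
Local Notation Q := (G <*> X^`(1))%G.
Local Notation F := (C :&: (G <*> X^`(1)))%G.
Local Notation R0 := (X^`(1) :&: C)%G.

Let abR : abelian R := Ito_der1_abelian defX cGG cCC.
Let nRX : X \subset 'N(R) := der_norm 1 X.
Let sRX : R \subset X := der_sub 1 X.
Let sRQ : R \subset Q := joing_subr _ _.
Let sGQ : G \subset Q := joing_subl _ _.
Let sQX : Q \subset X. Proof. by rewrite join_subG sGX. Qed.
Let defQ : Q = G * R :> {set gT}.
Proof. by rewrite /= norm_joinEl // (subset_trans sGX nRX). Qed.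
Let pQ : p.-group Q. Proof. by rewrite defQ pgroupM pG. Qed.
Let sFC : F \subset C := subsetIl _ _.
Let sFQ : F \subset Q := subsetIr _ _.
Let sR0R : R0 \subset R := subsetIl _ _.

(** Both are complements of [G] in [G R]: the modular law gives [G F = G R]. *)
Lemma card_cyclic_part : #|F| = #|R|.
Proof.
have /(congr1 (fun A : {set gT} => #|A|)) : G * F = G * R.
  by rewrite /= group_modl //= defX -defQ (setIidPr sQX).
rewrite !TI_cardMg //; last by rewrite setIA tiGC setI1g.
by move/eqP; rewrite eqn_pmul2l // => /eqP.
Qed.

(** The image of [F] in [Q / R] is cyclic inside an elementary abelian group, so [F :&: R] has index
    dividing [p] in [F], hence also in [R], which has the same order. *)
Lemma der1_cap_cyclic_index : #|R : R0| %| p.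
Proof.
have nRF : F \subset 'N(R) := subset_trans (subset_trans sFQ sQX) nRX.
have : #|F : R| %| p.
  rewrite -card_quotient //.
  have : cyclic (F / R) by rewrite quotient_cyclic // (cyclicS sFC).
  case/cyclicP=> x Ex; rewrite Ex -[#|_|]/(#[x]) order_dvdn.
  have : x \in G / R.
    by rewrite -quotientMidr -defQ (subsetP (quotientS _ sFQ)) // Ex cycle_id.
  by case/morphimP=> g nRg Gg ->;
    rewrite -morphX // (abelemP p_pr abelG).2 ?morph1.
have -> : #|F : R| = #|R : F :&: R|.
  apply/eqP; rewrite -indexgI -(@eqn_pmul2l #|F :&: R|) ?cardG_gt0 //.
  by rewrite !Lagrange ?subsetIl ?subsetIr // card_cyclic_part.
by apply: dvdn_trans;
  rewrite indexgS // subsetI subsetIr (subset_trans (subsetIl _ _)).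
Qed.

(** With [G] core-free, [cent_abelian_factor] applies with the factors exchanged: [C] is its own
    centraliser. *)
Lemma cent_der1_cyclic : 'C_R(C) = R0.
Proof.
by rewrite /= -{2}(cent_abelian_factor defX' cCC cGG coreG) setIA (setIidPl sRX).
Qed.

Lemma der1_cap_cyclic_normal : R0 <| X.
Proof. exact: der1_cap_factor_normal defX' cCC cGG coreG. Qed.

Lemma centCG : 'C_G(C) = 1.
Proof.
apply/trivgP; rewrite -tiGC subsetI subsetIl.
by rewrite /= -{2}(cent_abelian_factor defX' cCC cGG coreG) setSI.
Qed.

Lemma comm_generator_inj c : C :=: <[c]> -> {in G &, injective (fun g => [~ g,
  c])}.
Proof.
move=> defC g h Gg Gh /= E.
have : g * h^-1 \in 'C_G(C).
  rewrite inE groupM ?groupV //= defC cent_cycle; apply/cent1P/commgP/conjg_fixP.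
  by rewrite conjMg conjVg !conjg_mulR E invMg -mulgA mulKVg.
by rewrite centCG => /set1gP/(canRL (mulgKV _)); rewrite mul1g.
Qed.

Hypothesis ntR : R != 1 :> {set gT}.

Let nsR0Q : R0 <| Q.
Proof.
by rewrite (normalS _ sQX der1_cap_cyclic_normal) // (subset_trans sR0R).
Qed.

Lemma comm_der1_cap_cyclic : [~: R, Q] \subset R0.
Proof.
apply: comm_sub_prime_index pQ nsR0Q _ sR0R der1_cap_cyclic_index => //.
by rewrite (normalS _ sQX) ?der_normal.
Qed.

(** For [f = g * r] in [F] and [h] in [G], [[~ f, h] = [~ r, h]] lies in [R0], which is contained in
    [F]. *)
Lemma cyclic_part_norm : G \subset 'N(F).
Proof.
have sR0F : R0 \subset F by rewrite subsetI subsetIr (subset_trans sR0R).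
apply/subsetP=> h Gh; rewrite inE; apply/subsetP=> _ /imsetP[f Ff ->].
rewrite conjg_mulR groupM //; apply: (subsetP sR0F).
have /mulsgP[g r Gg Rr ->] : f \in G * R by rewrite -defQ (subsetP sFQ).
rewrite commMgJ; have /commgP/eqP-> : commute g h by apply: (centsP cGG).
by rewrite conj1g mul1g (subsetP comm_der1_cap_cyclic) // mem_commg // (subsetP
  sGQ).
Qed.

(** Otherwise [R] has order 2, so [C] centralises it and [R = 'C_R(C) = R0] is trivial. *)
Lemma der1_cap_cyclic_neq1 : p = 2 -> R0 != 1 :> {set gT}.
Proof.
move=> p2; apply/eqP=> R01.
have R2 : #|R| = 2.
  have /primeP[_ /(_ #|R|)] := p_pr; have := der1_cap_cyclic_index;
    rewrite R01 indexg1 => dvd.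
  by move=> /(_ dvd); rewrite p2 -trivg_card1 (negPf ntR) => /eqP.
have := cent_der1_cyclic; rewrite R01 => cR1.
have := norm_card2_cent R2 (subset_trans sCX nRX); rewrite centsC => cRC.
by case/eqP: ntR; rewrite -cR1; apply/esym/setIidPl.
Qed.

Section Odd.

Hypothesis p_odd : p != 2.

(* A generator [g * r] of [F] has the same [p]-th power as [r], since [~ r, g] *)
(* commutes with [g] and [r] and has order dividing [p]; as #|F| = #|R|, this   *)
(* [r] generates [R], unless [R] has order dividing [p].                        *)
Lemma der1_cyclic : cyclic R.
Proof.
have /cyclicP[f defF] : cyclic F := cyclicS sFC cycC.
have Ff : f \in F by rewrite /= defF cycle_id.
have Qf := subsetP sFQ f Ff; have Cf := subsetP sFC f Ff.
have /mulsgP[g r Gg Rr Ef] : f \in G * R by rewrite -defQ.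
have R0rf : [~ r, f] \in R0.
  by apply: subsetP comm_der1_cap_cyclic _ _; rewrite mem_commg.
have cr x : x \in R -> commute x r by move=> Rx; apply: (centsP abR).
have [Rrf Crf] : [~ r, f] \in R /\ [~ r, f] \in C by apply/setIP.
have Eg : g = f * r^-1 by rewrite Ef mulgK.
have Erg : [~ r, g] = [~ r, f].
  rewrite Eg commgMJ; have /commgP/eqP-> : commute r r^-1 by apply/commuteV.
  by rewrite mul1g; apply/conjg_fixP/commgP/commuteV/cr.
have cf x : x \in C -> commute x f by move=> Cx; apply: (centsP cCC).
have cg : commute g [~ r, g].
  rewrite Erg; rewrite Eg.
  by apply/commute_sym/commuteM; [apply: cf | apply/commuteV/cr].
have cr' : commute r [~ r, g] by rewrite Erg; apply/commute_sym/cr.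
(* [r ^+ p] lies in [R0], hence in [C], and commutes with [f]; so [r] and [r ^ f = r * [~ r, f]]
   have the same [p]-th power. *)
have rfp : [~ r, f] ^+ p = 1.
  have R0rp : r ^+ p \in R0.
    have nR0r : r \in 'N(R0).
      exact: subsetP (normal_norm der1_cap_cyclic_normal) r (subsetP sRX r Rr).
    have /andP[_ nR0R] := normalS sR0R sRX der1_cap_cyclic_normal.
    apply: coset_idr; rewrite ?groupX // morphX //; apply/eqP.
    rewrite -order_dvdn (dvdn_trans (order_dvdG (mem_quotient _ Rr))) //.
    by rewrite card_quotient // der1_cap_cyclic_index.
  have crpf : commute (r ^+ p) f by apply: cf; case/setIP: R0rp.
  have : (r * [~ r, f]) ^+ p = r ^+ p.
    by rewrite -conjg_mulR -conjXg; apply/conjg_fixP/commgP.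
  by rewrite expgMn -?Erg // => /(canRL (mulKg _)); rewrite mulVg.
have fp : f ^+ p = r ^+ p.
  rewrite Ef expMg_Rmul // (abelemP p_pr abelG).2 // mul1g Erg.
  have /dvdnP[q ->] := prime_dvd_bin2 p_pr p_odd.
  by rewrite mulnC expgM rfp expg1n mulg1.
have oF : #[f] = #|R| by rewrite -card_cyclic_part /= defF.
have [f1|ntf] := eqVneq (f ^+ p) 1.
  have := primeP p_pr => -[_ /(_ #|R|)];
    rewrite -oF order_dvdn f1 eqxx => /(_ isT).
  rewrite oF => /orP[/eqP R1|/eqP Rp]; last by rewrite prime_cyclic // Rp.
  by rewrite (card1_trivg R1) cyclic1.
have <- : <[r]> = R.
  have [pf pr] : p.-elt f /\ p.-elt r by rewrite (mem_p_elt pQ) // (mem_p_elt pR).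
  apply/eqP; rewrite eqEcard cycle_subG Rr -oF (order_eq_of_expp p_pr pf pr fp
    ntf) //=.
exact: cycle_cyclic.
Qed.

(** Both [g] and [g ^ c = g * [~ g, c]] have trivial [p]-th power, and [g] normalises every subgroup
    of the cyclic [R]; [exp_eq1_of_conj] then puts [[~ g, c]] in ['Ohm_1(R)], of order [p]. *)
Lemma card_elementary_le : #|G| <= p.
Proof.
have /cyclicP[c defC] := cycC.
have ntR' := Ohm1_cyclic_pgroup_prime der1_cyclic pR ntR.
rewrite -ntR' -(card_in_imset (comm_generator_inj defC)) subset_leq_card //.
apply/subsetP=> _ /imsetP[g Gg ->]; set y := [~ g, c].
have Cc : c \in C by rewrite defC cycle_id.
have Ry : y \in R by rewrite /= derg1 mem_commg ?(subsetP sGX g) ?(subsetP sCX c).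
rewrite (OhmE 1 pR) mem_gen //; apply/LdivP; rewrite expn1; split=> //.
have [_ Gp] := abelemP p_pr abelG.
apply: (exp_eq1_of_conj p_pr p_odd _ _ (Gp g Gg)).
- exact: mem_p_elt pR Ry.
- have : <[y]> \char R by rewrite sub_cyclic_char ?cycle_subG ?der1_cyclic.
  by move/char_norm_trans/(_ (subset_trans sGX nRX))/subsetP; apply.
by rewrite -conjg_mulR -conjXg Gp // conj1g.
Qed.

End Odd.
End CoreFreeElementary.

(** * The index of the core of [G] *)

Section CoreQuotient.

Variables (gT : finGroupType) (p : nat) (G C X : {group gT}).
Hypotheses (p_pr : prime p) (abelG : p.-abelem G) (cycC : cyclic C).
Hypotheses (defX : G * C = X) (tiGC : G :&: C = 1) (coreC : gcore C X = 1).

Let pG : p.-group G. Proof. exact: abelem_pgroup abelG. Qed.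
Let cGG : abelian G. Proof. exact: abelem_abelian abelG. Qed.
Let cCC : abelian C. Proof. exact: cyclic_abelian cycC. Qed.
Let sGX : G \subset X. Proof. by rewrite -defX mulG_subl. Qed.
Let sCX : C \subset X. Proof. by rewrite -defX mulG_subr. Qed.
Let defX' : C * G = X.
Proof. by rewrite -defX; apply/esym/comm_group_setP; rewrite defX groupP. Qed.

Let N := (gcore G X)%G.
Let nNX : X \subset 'N(N) := gcore_norm G X.
Let sNG : N \subset G := gcore_sub G X.
Let nNG : G \subset 'N(N) := subset_trans sGX nNX.
Let nNC : C \subset 'N(N) := subset_trans sCX nNX.

Let nNX' : X^`(1) \subset 'N(N) := subset_trans (der_sub 1 X) nNX.

Let abelGb : p.-abelem (G / N). Proof. exact: quotient_abelem. Qed.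
Let cycCb : cyclic (C / N). Proof. exact: quotient_cyclic. Qed.
Let defXb : (G / N) * (C / N) = X / N. Proof. by rewrite -quotientMl ?defX. Qed.
Let tiGCb : G / N :&: C / N = 1. Proof. by rewrite -quotientGI // tiGC
  quotient1. Qed.
Let pRb : p.-group (X / N)^`(1).
Proof. by rewrite -quotient_der // quotient_pgroup // (der1_pgroup abelG cycC
  defX coreC). Qed.
Let tiGRb : G / N :&: (X / N)^`(1) = 1.
Proof.
rewrite -quotient_der // -quotientGI // setIC; apply: quotientS1.
apply: gcore_max; first exact: subsetIr.
by rewrite normal_norm // (der1_cap_factor_normal defX).
Qed.
Let coreGb : gcore (G / N) (X / N) = 1.
Proof.
have nsNX : N <| X by rewrite /normal (subset_trans sNG).
have [K defK sNK nsKX] := inv_quotientN nsNX (gcore_normal (quotientS N sGX)).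
rewrite defK quotientS1 // gcore_max ?normal_norm //.
by rewrite -(quotientSGK _ sNG) -?defK ?gcore_sub // (subset_trans (normal_sub
  nsKX)).
Qed.

Lemma der1_quotient_normal : (X / N)^`(1) = 1 -> G <| X.
Proof.
rewrite -quotient_der // => /trivgP; rewrite quotient_sub1 // => sX'N.
by rewrite sub_der1_normal // (subset_trans sX'N).
Qed.

Lemma gcore_index_odd : p != 2 -> ~~ (G <| X) -> #|G : N| = p.
Proof.
move=> p2 nnGX.
have [/der1_quotient_normal|ntR] := eqVneq (X / N)^`(1) 1;
  first by rewrite (negPf nnGX).
have := card_elementary_le p_pr abelGb cycCb defXb tiGCb coreGb pRb tiGRb ntR p2.
rewrite card_quotient // => le_p.
have ntG : G / N != 1.
  apply: contra nnGX => /eqP/trivgP; rewrite quotient_sub1 // => sGN.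
  by rewrite -(eqP (_ : N == G)) ?gcore_normal // eqEsubset sNG.
have [_ p_dvd _] := pgroup_pdiv (quotient_pgroup N pG) ntG.
rewrite card_quotient // in p_dvd.
by apply/eqP; rewrite eqn_leq le_p dvdn_leq.
Qed.

(** The abelian group [G] centralises [N], so [X / 'C_X(N)] is an image of [C], hence abelian. *)
Let centN : G <*> X^`(1) \subset 'C(N).
Proof.
have sGC : G \subset 'C(N) by rewrite centsC (subset_trans sNG).
rewrite join_subG sGC /=.
have nCX : X \subset 'N('C(N)) by rewrite norms_cent.
suff : X^`(1) \subset 'C_X(N) by rewrite subsetI => /andP[].
have nCC : X \subset 'N('C_X(N)) by rewrite normsI ?normG.
apply: der1_min => //.
have sGCX : G \subset 'C_X(N) by rewrite subsetI sGX.
have <- : (C * G) / 'C_X(N) = X / 'C_X(N) by rewrite defX'.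
by rewrite quotientMl ?(subset_trans sCX) // (quotientS1 sGCX) mulg1
  quotient_abelian.
Qed.

(* The involution [z] of [C] maps into the derived subgroup [R] of [X / N].  If *)
(* #|R| = 2 then [~ h, c] is in [N] or [N z] and has order at most 2, so it is  *)
(* centralised by [h].  Otherwise [z = f ^+ 2] with [f] in [C] centralising [N] *)
(* and <[f]> normalised by [G] modulo [N].                                      *)
Lemma elementary2_normal : p = 2 -> G <| X.
Proof.
move=> p2; apply/negPn/negP=> nnGX.
have [/der1_quotient_normal|ntR] := eqVneq (X / N)^`(1) 1;
  first by rewrite (negPf nnGX).
have ntR0 := der1_cap_cyclic_neq1 p_pr abelGb cycCb defXb tiGCb coreGb tiGRb ntR
  p2.
pose R : {group _} := (X / N)^`(1)%G; pose R0 := (R :&: (C / N))%G.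
pose F := (C / N :&: (G / N <*> R))%G.
have nsR0X : R0 <| X / N.
  exact: der1_cap_cyclic_normal abelGb cycCb defXb coreGb.
have sR0C : R0 \subset C / N := subsetIr _ _.
have sR0F : R0 \subset F by rewrite subsetI sR0C (subset_trans (subsetIl _ _))
  ?joing_subr.
have cycF : cyclic F := cyclicS (subsetIl _ _) cycCb.
have oF : #|F| = #|R| := card_cyclic_part defXb tiGCb tiGRb.
have pF : 2.-group F.
  by rewrite /pgroup oF -p2.
have [_ R0even _] := pgroup_pdiv (pgroupS sR0F pF) ntR0.
have [z0 R0z0 oz0] := Cauchy (isT : prime 2) R0even.
have nz0 : X / N \subset 'N(<[z0]>).
  apply: char_norm_trans (normal_norm nsR0X).
  by rewrite sub_cyclic_char ?cycle_subG // (cyclicS sR0F).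
have liftC x : x \in C -> coset N x \in F -> x \in 'C(N).
  have defQb : G / N <*> R = (G <*> X^`(1)) / N by rewrite quotientY
    ?quotient_der.
  move=> Cx /setIP[_]; rewrite /= defQb => Fx.
  apply: (subsetP centN);
    rewrite -cycle_subG -(quotientSGK (H := N)) ?cycle_subG ?(subsetP nNC) //.
    by rewrite quotient_cycle ?(subsetP nNC) // cycle_subG.
  by rewrite (subset_trans sNG) ?joing_subl.
have cN1 x : x \in C -> coset N x = 1 -> x = 1.
  move=> Cx /coset_idr Nx; apply/set1gP; rewrite -tiGC inE Cx andbT.
  by rewrite (subsetP sNG) // Nx // (subsetP nNC).
have [z Cz Ez] : exists2 z, z \in C & coset N z = z0.
  by have /morphimP[z _ Cz ->] := subsetP sR0C _ R0z0; exists z.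
have nNz := subsetP nNC z Cz.
have cNz : z \in 'C(N) by rewrite liftC // Ez (subsetP sR0F).
have z2 : z ^+ 2 = 1.
  by apply: cN1; rewrite ?groupX // morphX //= Ez -oz0 expg_order.
have ntz : z != 1.
  by apply: contraTneq isT => z1; move: oz0; rewrite -Ez z1 morph1 order1.
have oz : #[z] = 2 by apply: nt_prime_order.
have Gp x : x \in G -> x ^+ 2 = 1 by rewrite -p2; apply: (abelemP p_pr abelG).2.
(* [G] is self-centralising, so [z] would lie in [G :&: C = 1]. *)
suff cGz : z \in 'C(G).
  case/eqP: ntz; apply/set1gP; rewrite -tiGC inE Cz andbT.
  rewrite -(cent_abelian_factor defX cGG cCC coreC) inE cGz andbT.
  exact: subsetP sCX z Cz.
have cent_z h : h \in G -> z ^ h \in <[z]> -> commute z h.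
  move=> Gh; rewrite cycle2g // !inE conjg_eq1 (negPf ntz) /= => /eqP zh.
  by apply/commgP/conjg_fixP.
apply/centP=> h Gh; have nNh := subsetP nNG h Gh.
have [R2 | nR2] := eqVneq #|R| 2.
  have /cyclicP[c defC] := cycC; have Cc : c \in C by rewrite defC cycle_id.
  have nNc := subsetP nNC c Cc.
  have defR : R = <[z0]> :> {set _}.
    have oZ0 : #|<[z0]>| = 2 := oz0.
    by apply/esym/eqP; rewrite eqEcard oZ0 R2 leqnn cycle_subG andbT;
      case/setIP: R0z0.
  have : coset N [~ h, c] \in R by rewrite morphR //= derg1 mem_commg
    ?mem_quotient ?(subsetP sGX h) ?(subsetP sCX c).
  have nNy : [~ h, c] \in 'N(N) by rewrite groupR.
  rewrite defR cycle2g // !inE => /orP[/eqP|/eqP Ey].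
    rewrite morphR // => /eqP/commgP cmhc.
    have : coset N h \in 'C_(G / N)(C / N).
      rewrite inE mem_quotient //= defC quotient_cycle // cent_cycle.
      exact/cent1P.
    rewrite (centCG abelGb cycCb defXb tiGCb coreGb) => /set1gP/coset_idr Nh.
    by apply: (centP cNz); apply: Nh.
  have [n Nn En] : exists2 n, n \in N & [~ h, c] = n * z.
    by exists ([~ h, c] * z^-1);
      rewrite ?mulgKV // coset_idr ?groupM ?groupV // morphM ?morphV ?groupV //=
        Ey Ez mulgV.
  have cnz : commute n z by apply/commute_sym/(centP cNz).
  have cnh : commute n h by apply: (centsP cGG) => //; apply: (subsetP sNG).
  (* Here [h * (n * z)] is [h ^ c]. As [n] commutes with [h * z] and [n ^+ 2 = 1], also
     [(h * z) ^+ 2 = 1], which makes [h] and [z] commute. *)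
  have : (h * (n * z)) ^+ 2 = 1 by rewrite -En -conjg_mulR -conjXg Gp // conj1g.
  have cnhz : commute n (h * z) by apply: commuteM.
  rewrite mulgA -cnh -mulgA (expgMn _ cnhz) Gp ?(subsetP sNG) // mul1g => hz2.
  have inv2 (x : gT) : x ^+ 2 = 1 -> x^-1 = x by move=> x2; apply/eqP;
    rewrite eq_invg_mul; apply/eqP.
  by rewrite /commute -[RHS](inv2 _ hz2) invMg (inv2 z z2) (inv2 h (Gp h Gh)).
(* [F] is a cyclic 2-group of order [#|R| != 2]; were [z0] an odd power of a generator, it would
   generate [F]. *)
have [f0 Ff0 Ef0] : exists2 f0, f0 \in F & f0 ^+ 2 = z0.
  have /cyclicP[x defF] := cycF.
  have /cycleP[i Ei] : z0 \in <[x]> by rewrite -defF (subsetP sR0F).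
  have Fx : x \in F by rewrite defF cycle_id.
  have [oddi|eveni] := boolP (odd i); last first.
    exists (x ^+ i./2); first exact: groupX.
    by rewrite -expgM muln2 even_halfK.
  case/eqP: nR2; rewrite -oF defF -[#|_|]/(#[x]) -oz0 Ei orderXgcd.
  have [k ->] := p_natP (mem_p_elt pF Fx).
  rewrite (eqP (_ : coprime (2 ^ k) i)) ?divn1 //.
  by rewrite coprimeXl // coprime2n.
have /setIP[Cf0 _] := Ff0.
have /morphimP[f nNf Cf Ef] := Cf0.
have cNf : f \in 'C(N) by rewrite liftC //= -Ef.
have f2 : f ^+ 2 = z.
  apply/eqP; rewrite eq_mulgV1; apply/eqP/cN1;
    first by rewrite groupM ?groupV ?groupX.
  by rewrite morphM ?morphV ?morphX ?groupV ?groupX //= -[coset N f]Ef Ef0 Ez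
    mulgV.
have : f0 ^ coset N h \in <[f0]>.
  have nFh : coset N h \in 'N(F).
    have /subsetP-> // := cyclic_part_norm p_pr abelGb cycCb defXb tiGCb coreGb
      pRb tiGRb.
    exact: mem_quotient.
  have chf : <[f0]> \char F by rewrite sub_cyclic_char ?cycle_subG.
  rewrite memJ_norm ?cycle_id //.
  by apply: (subsetP (char_norm_trans chf (subxx _))).
rewrite Ef -morphJ //= => /cycleP[i]; rewrite -morphX // => Efh.
have [n Nn En] : exists2 n, n \in N & f ^ h = n * f ^+ i.
  exists (f ^ h * (f ^+ i)^-1); last by rewrite mulgKV.
  by apply: coset_idr;
    rewrite ?groupM ?groupV ?groupX ?groupJ // morphM ?morphV ?groupV ?groupX
      ?groupJ //= Efh mulgV.
(* Squaring [f ^ h = n * f ^+ i] removes [n], so [z ^ h = z ^+ i]. *)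
apply: cent_z => //; rewrite -f2 conjXg En expgMn; last first.
  by apply/commuteX/commute_sym/(centP cNf).
by rewrite Gp ?(subsetP sNG) // mul1g -expgM mulnC expgM f2 mem_cycle.
Qed.

End CoreQuotient.

(** * The normal Sylow [p]-subgroup and its decomposition *)

Lemma normal_p_part (gT : finGroupType) (p k m : nat) (G X : {group gT}) (s :
  gT) :
    prime p -> p.-abelem G -> G * <[s]> = X -> G :&: <[s]> = 1 ->
    gcore <[s]> X = 1 -> #[s] = (k * p ^ m)%N -> ~~ (p %| k) ->
  exists P : {group gT}, [/\ G * <[s ^+ k]> = P, P <| X & p.-group P].
Proof.
move=> p_pr abelG defX tiGs core1 os p'k.
have pG := abelem_pgroup abelG.
have k_gt0 : 0 < k by case: k p'k {os}; rewrite ?dvdn0.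
have pm_gt0 : 0 < p ^ m by rewrite expn_gt0 prime_gt0.
have [sGX ssX] : G \subset X /\ <[s]> \subset X by rewrite -defX mulG_subl
  mulG_subr.
have [P sylP sGP] := Sylow_superset sGX pG.
have [sPX pP _] := and3P sylP.
have pX' := der1_pgroup abelG (cycle_cyclic s) defX core1.
have sX'P : X^`(1) \subset P.
  by rewrite (subset_trans _ (pcore_sub_Hall sylP)) // pcore_max ?der_normal.
exists P; split=> //; last exact: sub_der1_normal.
have defP : G * (<[s]> :&: P) = P by rewrite group_modl // defX (setIidPr sPX).
rewrite -[RHS]defP; congr (_ * _); apply/eqP.
rewrite (eq_subG_cyclic (cycle_cyclic s)) ?subsetIl ?cycleX //.
rewrite -[#|<[_ ^+ _]>|]/(#[_]) orderXdiv os ?dvdn_mulr // mulKn //.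
rewrite -(eqn_pmul2l (cardG_gt0 G)) -TI_cardMg; last by rewrite setIA tiGs setI1g.
rewrite [G * _]defP (card_Hall sylP) -defX TI_cardMg // -[#|<[_]>|]/(#[_]) os
  partnM ?muln_gt0 ?cardG_gt0 ?k_gt0 //.
rewrite (part_pnat_id pG) partnM // (part_p'nat (n := k)) ?p'natE //.
by rewrite mul1n part_pnat_id ?pnatX ?pnat_id.
Qed.

(** [N D] has index [p] in the [p]-group [P], hence is normal. It meets [G] in [N (D :&: G) = N], so
    it meets [B] trivially. *)
Lemma sdprod_index_p (gT : finGroupType) (p : nat) (G N B D P : {group gT}) :
    prime p -> p.-group P -> G * D = P -> G :&: D = 1 -> N <| P -> N \x B = G ->
  #|B| = p -> (N ><| D) ><| B = P.
Proof.
move=> p_pr pP defP tiGD /andP[sNP nNP] defG oB.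
have [_ defNB cNB tiNB] := dprodP defG.
have [sGP sDP] : G \subset P /\ D \subset P by rewrite -defP mulG_subl mulG_subr.
have [sNG sBG] : N \subset G /\ B \subset G by rewrite -defNB mulG_subl mulG_subr.
have nND := subset_trans sDP nNP.
have tiND : N :&: D = 1 by apply/trivgP; rewrite -tiGD setSI.
rewrite sdprodE // -norm_joinEr //.
have sTP : N <*> D \subset P by rewrite join_subG sNP.
have oP : #|P| = (#|N <*> D| * p)%N.
  by rewrite -defP TI_cardMg // norm_joinEr // TI_cardMg // -defNB TI_cardMg //
    oB mulnAC.
have nsTP : N <*> D <| P.
  apply: (p_maximal_normal pP); apply: p_index_maximal => //.
  by rewrite -divgS // oP mulKn.
have tiTB : N <*> D :&: B = 1.
  apply/trivgP;
    rewrite -tiNB subsetI subsetIr andbT /= -(setIidPl sBG) setIA setIAC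
      norm_joinEr //.
  by rewrite -group_modl // [D :&: G]setIC tiGD mulg1 subsetIl.
have sBP := subset_trans sBG sGP.
rewrite sdprodE ?(subset_trans sBP (normal_norm nsTP)) //.
by apply/eqP; rewrite eqEcard mul_subG //= TI_cardMg // oB oP.
Qed.

(** * The regular representation and the skew product as a core-free factorization *)

Lemma lreg_abelem (p : nat) (gT : finGroupType) :
  prime p -> p.-abelem [set: gT] -> p.-abelem (lreg gT).
Proof.
move=> p_pr /(abelemP p_pr)[cGG Gp]; apply/(abelemP p_pr); split.
  apply/centsP=> _ /imsetP[g _ ->] _ /imsetP[h _ ->].
  apply/permP=> x; rewrite !permM !lmulpE !mulgA; congr (_ * _).
  by apply: (centsP cGG); rewrite inE.
move=> _ /imsetP[g _ ->].
have E i : lmulp g ^+ i = lmulp (g ^+ i).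
  elim: i => [|i IHi]; apply/permP=> x; first by rewrite lmulpE perm1 mul1g.
  by rewrite expgSr permM IHi !lmulpE mulgA -expgS.
by rewrite E Gp ?inE //; apply/permP=> x; rewrite lmulpE mul1g perm1.
Qed.

Lemma rV_Zp_abelem (p n : nat) : prime p -> p.-abelem [set: 'rV['Z_p]_n].
Proof.
move=> p_pr; apply/(abelemP p_pr); split=> [|x _].
  by apply/centsP=> x _ y _; apply: GRing.addrC.
rewrite FinRing.zmodXgE; apply/matrixP=> i j; rewrite mulmxnE mxE.
by rewrite -GRing.mulr_natr pchar_Zp ?prime_gt1 // GRing.mulr0.
Qed.

Section SkewProduct.

Variables (gT : finGroupType) (sigma : {perm gT}).
Hypothesis skew_sigma : skew_morphism sigma.
Local Notation X := (skew_product skew_sigma).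

Lemma cycle_skew_fix1 x : x \in <[sigma]> -> x 1 = 1.
Proof.
case/cycleP=> i ->; have [s1 _] := skew_sigma.
by elim: i => [|i IHi]; rewrite ?perm1 // expgSr permM IHi.
Qed.

Lemma lreg_cap_skew : lreg gT :&: <[sigma]> = 1.
Proof.
apply/trivgP/subsetP=> _ /setIP[/imsetP[g _ ->] /cycle_skew_fix1].
by rewrite lmulpE mulg1 => ->; apply/set1P/permP=> x; rewrite lmulpE mul1g perm1.
Qed.

(** All powers of [sigma] fix 1, and left multiplications are transitive: a conjugate of [x] fixing
    1 means that [x] fixes [g]. *)
Lemma gcore_skew : gcore <[sigma]> X = 1.
Proof.
apply/trivgP/subsetP=> x Kx; apply/set1P/permP=> g; rewrite perm1.
have Xg : lmulp g \in X.
  by apply: (subsetP (mulG_subl _ _)); apply/imsetP; exists g.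
have : x ^ (lmulp g)^-1 \in gcore <[sigma]> X.
  by rewrite memJ_norm // groupV (subsetP (gcore_norm _ _)).
move/(subsetP (gcore_sub _ _))/cycle_skew_fix1.
rewrite /conjg invgK !permM lmulpE mulg1 => /(congr1 (lmulp g)).
by rewrite permKV lmulpE mulg1.
Qed.

End SkewProduct.

(** * Case analysis on [p], [m], [k] and the normality of [G] *)

Theorem theorem1p1 (p n : nat) (gT : finGroupType) (sigma : {perm gT})
    (k m : nat)
    (p_prime : prime p)
    (G_elem : [set: gT] \isog [set: 'rV['Z_p]_n])
    (skew_sigma : skew_morphism sigma)
    (sigma_order : #[sigma] = (k * p ^ m)%N)
    (sigma_ge2 : (2 <= #[sigma])%N)
    (p_ndiv_k : ~~ (p %| k)%N) :
  let G := lreg_group gT in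
  let X := skew_product skew_sigma in
  let GX := gcore G X in
  let P := G * <[sigma ^+ k]> in
  let complement (B : {group {perm gT}}) :=
    GX \x B = G /\ B \isog [set: 'Z_p] in
  [/\ group_set P /\ P <| X,
      G <| X \/ (exists B : {group {perm gT}}, complement B)
    & [\/ (m = 0%N \/ p = 2) /\ G ><| <[sigma]> = X,
          [/\ p <> 2, (1 <= m)%N, k = 1%N
            & G ><| <[sigma]> = X \/
              (exists2 B : {group {perm gT}}, complement B &
                 (GX ><| <[sigma]>) ><| B = X)]
        | [/\ p <> 2, (1 <= m)%N, (2 <= k)%N
            & [\/ G ><| <[sigma]> = X,
                  G <| P /\
                  (exists2 B : {group {perm gT}}, complement B &
                     ((GX \x B) ><| <[sigma ^+ k]>)
                       ><| <[sigma ^+ (p ^ m)%N]> = X)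
                | ~~ (G <| P) /\
                  (exists2 B : {group {perm gT}}, complement B &
                     ((GX ><| <[sigma ^+ k]>) ><| B)
                       ><| <[sigma ^+ (p ^ m)%N]> = X)]]]].

Proof.
move=> G X GX P complement.
have abelG : p.-abelem (lreg_group gT).
  by apply: lreg_abelem; rewrite // (isog_abelem G_elem) rV_Zp_abelem.
have tiGs : lreg_group gT :&: <[sigma]> = 1 := lreg_cap_skew skew_sigma.
have core1 : gcore <[sigma]> X = 1 := gcore_skew skew_sigma.
have defX : lreg_group gT * <[sigma]> = X by [].
have [P0 [defP nsP0X pP0]] :=
  normal_p_part p_prime abelG defX tiGs core1 sigma_order p_ndiv_k.
have sGX : lreg_group gT \subset X by rewrite -defX mulG_subl.
have sCX : <[sigma]> \subset X by rewrite -defX mulG_subr.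
have k_gt0 : 0 < k by case: (k) p_ndiv_k; rewrite ?dvdn0.
have pm_gt0 : 0 < p ^ m by rewrite expn_gt0 prime_gt0.
have splitX : G <| X -> G ><| <[sigma]> = X.
  by move=> nsGX; rewrite sdprodE ?(subset_trans sCX (normal_norm nsGX)).
have sDC : <[sigma ^+ k]> \subset <[sigma]> := cycleX sigma k.
have tiGD : lreg_group gT :&: <[sigma ^+ k]> = 1.
  by apply/trivgP; rewrite -tiGs setIS.
have sGXG : gcore_group (lreg_group gT) X \subset lreg_group gT := gcore_sub _ _.
have ex_complement : p != 2 -> ~~ (G <| X) ->
    exists2 B : {group {perm gT}}, complement B & #|B| = p.
  move=> p2 nnGX;
    have iG := gcore_index_odd p_prime abelG (cycle_cyclic sigma) defX tiGs
      core1 p2 nnGX.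
  have /splitsP[B /complP[tiB defB]] := abelem_splits abelG sGXG.
  have cGG := abelem_abelian abelG.
  have oB : #|B| = p.
    apply/eqP; rewrite -(eqn_pmul2l (cardG_gt0 (gcore_group (lreg_group gT) X)))
      -TI_cardMg //.
    by rewrite defB -iG Lagrange.
  have sBG : B \subset lreg_group gT by rewrite -defB mulG_subr.
  exists B => //; split; first by rewrite dprodE // (sub_abelian_cent2 cGG).
  have cycZ : cyclic [set: 'Z_p] by apply/cyclicP; exists Zp1; apply: Zp_cycle.
  rewrite isog_sym isog_cyclic_card // prime_cyclic oB //= cardsT card_ord
    Zp_cast //.
  exact: prime_gt1.
have oD : #|<[sigma ^+ k]>| = (p ^ m)%N.
  by rewrite -[LHS]/(#[_]) orderXdiv sigma_order ?dvdn_mulr // mulKn.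
have normal_case : m = 0 \/ p = 2 -> G <| X.
  case=> [m0|p2];
    last exact: elementary2_normal p_prime abelG (cycle_cyclic sigma) defX tiGs
      core1 p2.
  have D1 : <[sigma ^+ k]> = 1 by apply/eqP; rewrite trivg_card1 oD m0.
  by move: nsP0X; rewrite -defP D1 mulg1.
have sP0X := normal_sub nsP0X.
(* [<[sigma ^+ (p ^ m)]>] has order [k], prime to [p], and the orders multiply to [#|X|]. *)
have sdP : P0 ><| <[sigma ^+ (p ^ m)]> = X.
  have sC'X : <[sigma ^+ (p ^ m)]> \subset X := subset_trans (cycleX _ _) sCX.
  have oC' : #|<[sigma ^+ (p ^ m)]>| = k.
    by rewrite -[LHS]/(#[_]) orderXdiv sigma_order ?dvdn_mull // mulnK.
  have oP : #|P0| = (#|lreg_group gT| * p ^ m)%N by rewrite -defP TI_cardMg // oD.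
  have tiPC : P0 :&: <[sigma ^+ (p ^ m)]> = 1.
    apply: coprime_TIg; apply: (pnat_coprime (pi := p)); first exact: pP0.
    by rewrite oC' p'natE.
  rewrite sdprodE ?(subset_trans sC'X (normal_norm nsP0X)) //.
  have oX : #|X| = (#|lreg_group gT| * #[sigma])%N := TI_cardMg tiGs.
  apply/eqP; rewrite eqEcard mul_subG // oX TI_cardMg // oP oC' sigma_order.
  by rewrite (mulnC k) mulnA leqnn.
have nsGXX : gcore_group (lreg_group gT) X <| X := gcore_normal sGX.
have nsGXP : gcore_group (lreg_group gT) X <| P0.
  by rewrite (normalS _ sP0X) // (subset_trans sGXG) // -defP mulG_subl.
have sdB (B : {group {perm gT}}) : complement B -> #|B| = p -> (GX ><| <[sigma
  ^+ k]>) ><| B = P0.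
  by case=> defB _ oB; apply: sdprod_index_p pP0 defP tiGD nsGXP defB oB.
split.
- by rewrite /P defP groupP.
- have [nsGX|nnGX] := boolP (G <| X); [by left | right].
  have [p2|p2] := eqVneq p 2; first by case/negP: nnGX; apply: normal_case; right.
  by have [B] := ex_complement p2 nnGX; exists B.
have [p2|p2] := eqVneq p 2.
  by constructor 1; split; [right | apply/splitX/normal_case; right].
have [m0|m_gt0] := posnP m.
  by constructor 1; split; [left | apply/splitX/normal_case; left].
have p2' : p <> 2 by apply/eqP.
have [k1|k1] := eqVneq k 1%N.
  constructor 2; split=> //.
  have [nsGX|nnGX] := boolP (G <| X); [by left; apply: splitX | right].
  have [B cB oB] := ex_complement p2 nnGX; exists B => //.
  have := sdB B cB oB; rewrite -defP k1 expg1; apply.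
have k_gt1 : 1 < k by rewrite ltn_neqAle eq_sym k1.
constructor 3; split=> //.
have [nsGX|nnGX] := boolP (G <| X); first by constructor 1; apply: splitX.
have [B cB oB] := ex_complement p2 nnGX.
have [nsGP|nnGP] := boolP (G <| P).
  constructor 2; split=> //; exists B => //.
  have [-> _] := cB; rewrite sdprodE ?defP //.
  by rewrite (subset_trans _ (normal_norm nsGP)) // /P mulG_subr.
by constructor 3; split=> //; exists B => //; rewrite (sdB B cB oB).
Qed.
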